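(* There exist numerical constants $C,c>0$ such that, for any $n\in\mathbb{N}$ and any pair of ellipsoids $\mathcal{E},\mathcal{B}\subset\mathbb{R}^n$, one has \[\log M(\mathcal{E},\mathcal{B})\le C\log \hat{M}(\mathcal{E}, c\,\mathcal{B}).\]
   Context: Ellipsoids are (origin-symmetric, nondegenerate) sets of the form $T(B_2^n)$ with $B_2^n$ the closed Euclidean unit ball and $T$ an invertible linear map. Logarithms are to base 2. For a set $K$ and a symmetric convex body $B$, the packing number $M(K,B)$ is the maximal number of translates $x_i+B$ with $x_i\in K$ whose interiors are pairwise disjoint (possibly $+\infty$). The convex separation number is \[\hat{M}(K,B):=\sup\{N:\ \exists\, x_1,\dots,x_N\in K \text{ such that } (x_j+\mathrm{int}\,B)\cap \mathrm{conv}\{x_i: i<j\}=\emptyset \text{ for all } j\},\] where $\mathrm{int}$ denotes interior and $\mathrm{conv}$ the convex hull (possibly $+\infty$). *)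

(* Defs.v *)
From HB Require Import structures.
From mathcomp Require Import all_boot all_order all_algebra.
From mathcomp Require Import all_classical all_reals all_analysis.
Set Implicit Arguments. Unset Strict Implicit. Unset Printing Implicit Defensive.
Import Order.TTheory GRing.Theory Num.Theory.
Import numFieldNormedType.Exports.
Local Open Scope classical_set_scope.
Local Open Scope ring_scope.

Section Defs.
Variables (R : realType) (n : nat).

Definition unit_ball2 : set 'rV[R]_n := [set x | \sum_(i < n) (x ord0 i) ^+ 2 <= 1].

Definition is_ellipsoid (E : set 'rV[R]_n) : Prop :=
  exists T : 'M[R]_n, T \in unitmx /\ E = (fun x => x *m T) @` unit_ball2.

Definition scale_set (c : R) (B : set 'rV[R]_n) : set 'rV[R]_n := (fun x => c *: x) @` B.

Definition translate_int (x : 'rV[R]_n) (B : set 'rV[R]_n) : set 'rV[R]_n :=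
  (fun y => x + y) @` (interior B).

Definition conv_fin (N : nat) (x : 'I_N -> 'rV[R]_n) : set 'rV[R]_n :=
  [set y | exists l : 'I_N -> R, (forall i, 0 <= l i) /\ \sum_(i < N) l i = 1 /\
                                 y = \sum_(i < N) l i *: x i].

Definition packing_ok (K B : set 'rV[R]_n) (N : nat) : Prop :=
  exists x : 'I_N -> 'rV[R]_n, (forall i, K (x i)) /\
    (forall i j, i != j -> translate_int (x i) B `&` translate_int (x j) B = set0).

Definition convsep_ok (K B : set 'rV[R]_n) (N : nat) : Prop :=
  exists x : 'I_N -> 'rV[R]_n, (forall i, K (x i)) /\
    (forall j : 'I_N,
       translate_int (x j) B `&`
         conv_fin (fun i : 'I_j => x (widen_ord (ltnW (ltn_ord j)) i)) = set0).

Definition packing_number (K B : set 'rV[R]_n) : \bar R :=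
  ereal_sup [set (N%:R)%:E | N in packing_ok K B].

Definition convsep_number (K B : set 'rV[R]_n) : \bar R :=
  ereal_sup [set (N%:R)%:E | N in convsep_ok K B].

End Defs.

Definition log2 {R : realType} (x : R) : R := ln x / ln 2.

Definition elog2 {R : realType} (x : \bar R) : \bar R :=
  match x with
  | r%:E => (log2 r)%:E
  | +oo%E => +oo%E
  | -oo%E => -oo%E
  end.

(* Main.v *)
Require Import Defs.
From HB Require Import structures.
From mathcomp Require Import all_boot all_order all_algebra.
From mathcomp Require Import all_classical all_reals all_analysis.
From mathcomp Require Import complex ring lra.
Set Implicit Arguments. Unset Strict Implicit. Unset Printing Implicit Defensive.
Import Order.TTheory GRing.Theory Num.Theory.
Import numFieldNormedType.Exports.
Local Open Scope classical_set_scope.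
Local Open Scope ring_scope.

(* After a linear change of variables, B is the unit ball and E its image under
   a matrix T with polar decomposition T = S^2 U, S symmetric and U orthogonal.
   Let s be a subset of the ball whose image under S is 1-separated, and which
   is either maximal or as large as the packing.  By maximality, the unit balls
   centered at the image of s under S cover the image of the ball; applying S
   once more, |s|^2 unit balls cover the image of the ball under S^2, hence the
   packing has at most |s|^2 points.  On the other hand the points u T, u in s,
   listed by increasing |u S|, are convexly separated: the inner product of v T
   with the vector u U of the ball is <u S, v S>, and by polarization this
   exceeds at v = u every earlier value by at least 1/2. *)

Section PairwiseSeq.

Lemma ex_pairwise_maximal T (P : pred T) (r : rel T) N :
  exists s, [/\ all P s, pairwise r s &
    size s = N \/ forall u, P u -> ~~ all (r u) s].
Proof.
elim: N => [|N [s [Ps rs [sN|maxs]]]]; first by exists [::]; split=> //; left.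
- have [[u Pu us]|nex] := pselect (exists2 u, P u & all (r u) s).
    by exists (u :: s); rewrite /= Pu us sN; split=> //; left.
  exists s; split=> //; right=> u Pu; apply/negP => us.
  by apply: nex; exists u.
- by exists s; split=> //; right.
Qed.

Lemma perm_pairwise (T : eqType) (r : rel T) (s t : seq T) :
  symmetric r -> perm_eq s t -> pairwise r s = pairwise r t.
Proof.
move=> symr; apply: catCA_perm_subst => {s t} s1 s2 s3.
have symr12 : allrel r s1 s2 = allrel r s2 s1.
  by rewrite allrelC; apply: eq_allrel => x y; rewrite symr.
by rewrite !pairwise_cat !allrel_catr symr12 -!andbA; do ?bool_congr.
Qed.

Lemma pairwise_sort_sym (T : eqType) (leT r : rel T) (s : seq T) :
    total leT -> transitive leT -> symmetric r -> pairwise r s ->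
  pairwise [rel x y | leT x y && r x y] (sort leT s).
Proof.
move=> leT_total leT_tr symr rs; rewrite pairwise_relI.
rewrite -(sorted_pairwise leT_tr) sort_sorted//=.
by rewrite (perm_pairwise symr (_ : perm_eq _ s)) ?perm_sort.
Qed.

Lemma leq_size_injective (T : eqType) N (f : 'I_N -> T) (s : seq T) :
  injective f -> (forall k, f k \in s) -> (N <= size s)%N.
Proof.
move=> injf fs; rewrite -[N]size_enum_ord -(size_map f).
apply: uniq_leq_size => [|_ /mapP[k _ ->]//].
by rewrite map_inj_uniq ?enum_uniq.
Qed.

End PairwiseSeq.

Definition dotrv {R : fieldType} {n : nat} (u v : 'rV[R]_n) : R :=
  form_of_matrix idfun 1%:M u v.

HB.instance Definition _ (R : fieldType) (n : nat) :=
  Bilinear.copy (@dotrv R n) (form_of_matrix idfun 1%:M).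

Local Notation "''[' u , v ]" := (dotrv u v) : ring_scope.
Local Notation "''[' u ]" := '[u, u] : ring_scope.

Section DotProduct.
Variable R : fieldType.

Lemma dotrvE n (u v : 'rV[R]_n) : '[u, v] = (u *m v^T) 0 0.
Proof. by rewrite /dotrv /form_of_matrix mulmx1 trace_mx11 map_mx_id. Qed.

Lemma dnormE n (u : 'rV[R]_n) : '[u] = \sum_i u 0 i ^+ 2.
Proof. by rewrite dotrvE mxE; apply: eq_bigr => i _; rewrite mxE expr2. Qed.

Lemma dotrvC n (u v : 'rV[R]_n) : '[u, v] = '[v, u].
Proof. by rewrite !dotrvE -[u *m v^T]trmxK trmx_mul trmxK mxE. Qed.

Lemma dotrv_mulmx m n (A : 'M[R]_(m, n)) u v : '[u *m A, v] = '[u, v *m A^T].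
Proof. by rewrite !dotrvE trmx_mul trmxK mulmxA. Qed.

Lemma dnormN n (u : 'rV[R]_n) : '[- u] = '[u].
Proof. by rewrite linearNl linearNr opprK. Qed.

Lemma dnormZ n a (u : 'rV[R]_n) : '[a *: u] = a ^+ 2 * '[u].
Proof. by rewrite linearZl_LR linearZr_LR /= mulrA expr2. Qed.

Lemma dnormB n (u v : 'rV[R]_n) : '[u - v] = '[u] - '[u, v] *+ 2 + '[v].
Proof. by rewrite linearBl !linearBr/= (dotrvC v u); ring. Qed.

Lemma dotrv_orthogonal m n (U : 'M[R]_(m, n)) u v :
  U *m U^T = 1%:M -> '[u *m U, v *m U] = '[u, v].
Proof.
by move=> orthU; rewrite dotrvC dotrv_mulmx -mulmxA orthU mulmx1 dotrvC.
Qed.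

End DotProduct.

Section RealDotProduct.
Variables (R : realFieldType) (n : nat).
Implicit Types u v : 'rV[R]_n.

Lemma dnorm_ge0 u : 0 <= '[u].
Proof. by rewrite dnormE sumr_ge0// => i _; exact: sqr_ge0. Qed.

Lemma dnorm_gt0 u : (0 < '[u]) = (u != 0).
Proof.
rewrite lt_def dnorm_ge0 andbT dnormE; congr (~~ _).
rewrite psumr_eq0 => [|i _]; last exact: sqr_ge0.
apply/allP/eqP => [u0|-> i _]; last by rewrite mxE expr0n eqxx.
apply/rowP => i; have := u0 i (mem_index_enum _).
by rewrite sqrf_eq0 mxE => /eqP.
Qed.

Lemma dnormB_le u v : '[u - v] <= '[u] *+ 2 + '[v] *+ 2.
Proof.
have := dnorm_ge0 (u + v); rewrite dnormB linearDl !linearDr/= (dotrvC v u).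
by lra.
Qed.

Lemma dotrv_le1 u v : '[u] <= 1 -> '[v] <= 1 -> '[u, v] <= 1.
Proof. by have := dnorm_ge0 (u - v); rewrite dnormB; lra. Qed.

Lemma dotrvDhalf_le u v :
  1 <= '[u - v] -> '[u] <= '[v] -> '[v, u] + 2^-1 <= '[v].
Proof. by rewrite dnormB (dotrvC v u); lra. Qed.

End RealDotProduct.

Lemma comm_mx_diag_map (R : idomainType) n (A : 'M[R]_n) (d : 'rV[R]_n)
    (f : R -> R) :
  comm_mx A (diag_mx d) -> comm_mx A (diag_mx (map_mx f d)).
Proof.
rewrite /comm_mx => Ad; apply/matrixP => i j; move/matrixP/(_ i j): Ad.
rewrite !mul_mx_diag !mul_diag_mx !mxE => Adij.
have [->|dij] := eqVneq (d 0 i) (d 0 j); first by rewrite mulrC.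
have /eqP : (d 0 i - d 0 j) * A i j = 0 by rewrite mulrBl -Adij mulrC subrr.
by rewrite mulf_eq0 subr_eq0 (negbTE dij) /= => /eqP->; rewrite mul0r mulr0.
Qed.

(* [P *m P^T] commutes with [diag_mx d], hence with any function of it. *)
Lemma symmetric_diag_map (R : fieldType) n (A P : 'M[R]_n) (d : 'rV[R]_n)
    (f : R -> R) :
    A^T = A -> P \in unitmx -> P *m A = diag_mx d *m P ->
  (invmx P *m diag_mx (map_mx f d) *m P)^T =
  invmx P *m diag_mx (map_mx f d) *m P.
Proof.
move=> symA unitP PA; have unitPT : P^T \in unitmx by rewrite unitmx_tr.
have /(comm_mx_diag_map f) PPf : comm_mx (P *m P^T) (diag_mx d).
  rewrite /comm_mx [RHS]mulmxA -PA -[LHS]mulmxA -{1}(tr_diag_mx d) -trmx_mul.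
  by rewrite -PA trmx_mul symA mulmxA.
rewrite !trmx_mul tr_diag_mx trmx_inv.
apply: (can_inj (mulKmx unitP)); apply: (can_inj (mulmxK unitPT)).
by rewrite !mulmxA mulmxV// mul1mx PPf -!mulmxA mulVmx// mulmx1.
Qed.

Lemma symmetric_diagonalizable (R : rcfType) n (A : 'M[R]_n) :
  A^T = A -> diagonalizable A.
Proof.
move=> symA; pose toC := real_complex R; pose AC := map_mx toC A.
have realAC : AC \is a mxOver Num.real.
  by apply/mxOverP => i j; rewrite mxE; apply/complex_realP; eexists.
have hermAC : AC \is hermitianmx n false Num.conj.
  apply: realsym_hermsym realAC.
  by apply/is_hermitianmxP; rewrite expr0 scale1r map_mx_id// /AC map_trmx symA.
pose D := spectral_diag AC.
have realD : D \is a mxOver Num.real := hermitian_spectral_diag_real hermAC.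
have real_diagD : diag_mx D \is a mxOver Num.real.
  by apply/mxOverP => i j; rewrite mxE rpredMn// (mxOverP realD).
have simAD : similar_in unitmx AC (diag_mx D).
  have unitU := spectral_unit AC; exists (spectralmx AC) => //.
  apply/(similarP unitU).
  rewrite {2}(orthomx_spectralP (hermitian_normalmx hermAC)) !mulmxA.
  by rewrite mulmxV// mul1mx.
have [Q /andP[/= realQ unitQ] /(similarP unitQ) QAC] :=
  real_similar simAD realAC real_diagD.
have ReK m p (M : 'M[R[i]]_(m, p)) : M \is a mxOver Num.real ->
    map_mx toC (map_mx (@complex.Re R) M) = M.
  move=> realM; apply/matrixP => i j.
  by rewrite !mxE /toC RRe_real// (mxOverP realM).
pose P := map_mx (@complex.Re R) Q.
have unitP : P \in unitmx by rewrite -(map_unitmx toC) ReK.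
exists P => //; apply/similar_diagPex; exists (map_mx (@complex.Re R) D).
apply/(similarP unitP)/(map_mx_inj (f := toC)).
by rewrite !map_mxM map_diag_mx !ReK.
Qed.

Definition psdmx {R : realFieldType} {n} (A : 'M[R]_n) : Prop :=
  A^T = A /\ forall u : 'rV[R]_n, 0 <= '[u *m A, u].

Lemma psdmx_gram (R : realFieldType) m n (A : 'M[R]_(m, n)) :
  psdmx (A *m A^T).
Proof.
split=> [|u]; first by rewrite trmx_mul trmxK.
by rewrite mulmxA dotrv_mulmx trmxK dnorm_ge0.
Qed.

Lemma psdmx_diag_ge0 (R : realFieldType) n (A P : 'M[R]_n) (d : 'rV[R]_n) i :
  psdmx A -> P \in unitmx -> P *m A = diag_mx d *m P -> 0 <= d 0 i.
Proof.
move=> [_ psdA] unitP PA; have := psdA (row i P).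
have -> : row i P *m A = d 0 i *: row i P.
  by apply/rowP => j; rewrite -row_mul PA mul_diag_mx !mxE.
rewrite linearZl_LR/= pmulr_lge0// dnorm_gt0.
apply: contraTneq unitP => Pi0; rewrite -row_free_unit.
by apply/row_freePn; exists i; rewrite Pi0 sub0mx.
Qed.

Lemma psdmx_sqrt (R : rcfType) n (A : 'M[R]_n) :
  psdmx A -> exists2 S, psdmx S & S *m S = A.
Proof.
move=> psdA; have [symA _] := psdA.
have [P unitP /similar_diagPex[d /(similarP unitP) PA]] :=
  symmetric_diagonalizable symA.
pose fd (f : R -> R) := invmx P *m diag_mx (map_mx f d) *m P.
have fdT f : (fd f)^T = fd f by exact: symmetric_diag_map symA unitP PA.
have fdM f g : fd f *m fd g = fd (f \* g).
  rewrite /fd !mulmxA mulmxK// -[_ *m diag_mx _ *m diag_mx _]mulmxA mulmx_diag.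
  by congr (_ *m diag_mx _ *m _); apply/rowP => i; rewrite !mxE.
have sqrt_fd f : (forall i, 0 <= f (d 0 i)) ->
    fd (Num.sqrt \o f) *m fd (Num.sqrt \o f) = fd f.
  move=> f0; rewrite fdM /fd; congr (_ *m diag_mx _ *m _).
  by apply/rowP => i; rewrite !mxE /= -expr2 sqr_sqrtr.
exists (fd Num.sqrt).
  rewrite -sqrt_fd => [|i]; last exact: sqrtr_ge0.
  by rewrite -{2}fdT; exact: psdmx_gram.
rewrite -[Num.sqrt]/(Num.sqrt \o id) sqrt_fd => [|i].
  by rewrite /fd map_mx_id// -mulmxA -PA mulKmx.
exact: psdmx_diag_ge0 psdA unitP PA.
Qed.

Lemma polar_decomposition (R : rcfType) n (A : 'M[R]_n) : A \in unitmx ->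
  exists P U, [/\ psdmx P, U *m U^T = 1%:M & A = P *m U].
Proof.
move=> unitA; have [P psdP PP] := psdmx_sqrt (psdmx_gram A).
have unitP : P \in unitmx.
  have : P *m P \in unitmx by rewrite PP unitmx_mul unitmx_tr unitA.
  by rewrite unitmx_mul andbb.
exists P, (invmx P *m A); split=> //; last by rewrite mulKVmx.
rewrite trmx_mul trmx_inv psdP.1 mulmxA -(mulmxA _ A) -PP.
by rewrite mulmxA mulVmx// mul1mx mulmxV.
Qed.

Section BallCover.
Variable R : realFieldType.

Definition ball_cover m n (A : 'M[R]_(m, n)) (cs : seq 'rV[R]_n) : Prop :=
  forall u, '[u] <= 1 -> exists2 c, c \in cs & '[u *m A - c] < 1.

Definition ball_separated m n (A : 'M[R]_(m, n)) (s : seq 'rV[R]_m) : bool :=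
  all (fun u => '[u] <= 1) s && pairwise (fun u v => 1 <= '[(u - v) *m A]) s.

Lemma ex_ball_separated_cover m n (A : 'M[R]_(m, n)) N :
  exists2 s, ball_separated A s &
    size s = N \/ ball_cover A [seq u *m A | u <- s].
Proof.
have [s [s_ball s_sep maxs]] := ex_pairwise_maximal
  (fun u => '[u] <= 1) (fun u v => 1 <= '[(u - v) *m A]) N.
exists s; first by rewrite /ball_separated s_ball.
case: maxs => [sN|maxs]; first by left.
right=> u /maxs/allPn[v vs]; rewrite -ltNge mulmxBl => lt1.
by exists (v *m A) => //; exact: map_f.
Qed.

Lemma ball_separated_enum m n (A : 'M[R]_(m, n)) s : ball_separated A s ->
  exists x : 'I_(size s) -> 'rV[R]_m, (forall i, '[x i] <= 1) /\
    forall i j : 'I_(size s), (i < j)%N ->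
      '[x i *m A] <= '[x j *m A] /\ 1 <= '[x i *m A - x j *m A].
Proof.
move=> /andP[s_ball s_sep]; pose norm_le := relpre (fun u => '[u *m A]) <=%O.
have norm_le_total : total norm_le by move=> u v; exact: le_total.
have norm_le_trans : transitive norm_le by move=> u v w; exact: le_trans.
have sep_sym : symmetric (fun u v => 1 <= '[(u - v) *m A]).
  by move=> u v; rewrite -opprB mulNmx dnormN.
have := pairwise_sort_sym norm_le_total norm_le_trans sep_sym s_sep.
set t := sort _ s => /(pairwiseP 0) t_sep.
have size_t : size t = size s by rewrite size_sort.
exists (fun i => t`_i); split=> [i|i j ij].
  by apply: (allP s_ball); rewrite -(mem_sort norm_le) mem_nth// size_t.
have := t_sep i j; rewrite !inE size_t !ltn_ord => /(_ isT isT ij)/andP[].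
by rewrite mulmxBl.
Qed.

Lemma ball_cover_mulmx m n p (A : 'M[R]_(m, n)) (B : 'M[R]_(n, p)) cs ds :
    ball_cover A cs -> ball_cover B ds ->
  ball_cover (A *m B) [seq c *m B + d | c <- cs, d <- ds].
Proof.
move=> coverA coverB u /coverA[c cs_c /ltW/coverB[d ds_d]].
rewrite mulmxBl -mulmxA -addrA -opprD => lt1.
by exists (c *m B + d) => //; apply/allpairsP; exists (c, d).
Qed.

Lemma ball_cover_orthogonal m n p (A : 'M[R]_(m, n)) (U : 'M[R]_(n, p)) cs :
    U *m U^T = 1%:M -> ball_cover A cs ->
  ball_cover (A *m U) [seq c *m U | c <- cs].
Proof.
move=> orthU cover u /cover[c cs_c lt1]; exists (c *m U); first exact: map_f.
by rewrite mulmxA -mulmxBl dotrv_orthogonal.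
Qed.

Lemma leq_size_ball_cover m n (A : 'M[R]_(m, n)) cs N (x : 'I_N -> 'rV[R]_m) :
    ball_cover A cs -> (forall k, '[x k] <= 1) ->
    (forall k l, k != l -> 4 <= '[(x k - x l) *m A]) ->
  (N <= size cs)%N.
Proof.
move=> cover x_ball x_sep.
have /choice[c cP] k : exists c, c \in cs /\ '[x k *m A - c] < 1.
  by have [c] := cover _ (x_ball k); exists c.
apply: (leq_size_injective (f := c)) => [k l ckl|k]; last by case: (cP k).
apply/eqP; apply: contraT => /x_sep; rewrite mulmxBl.
have [[_ lt1k] [_ lt1l]] := (cP k, cP l); rewrite -ckl in lt1l.
have := dnormB_le (x k *m A - c k) (x l *m A - c k).
by rewrite opprB addrA subrK; lra.
Qed.

End BallCover.

Section PackingSeparation.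
Variables (R : realType) (n : nat).

Lemma packing_ok1 (K B : set 'rV[R]_n) x : K x -> packing_ok K B 1.
Proof. by exists (fun=> x); split=> // i j; rewrite !ord1 eqxx. Qed.

Lemma convsep_ok_functional (K B : set 'rV[R]_n) (t : R) N
    (x f : 'I_N -> 'rV[R]_n) :
    (forall i, K (x i)) ->
    (forall i j : 'I_N, (i < j)%N -> '[f j, x i] + t <= '[f j, x j]) ->
    (forall j b, B b -> - t < '[f j, b]) ->
  convsep_ok K B N.
Proof.
move=> xK fx fB; exists x; split=> // j.
rewrite -subset0 => _ [[b /interior_subset/(fB j) ltb <-]] [l [l_ge0 [suml]]].
move/(congr1 (dotrv (f j))); rewrite linearDr linear_sumr /=.
have : \sum_(i < j) '[f j, l i *: x (widen_ord (ltnW (ltn_ord j)) i)] <=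
       '[f j, x j] - t.
  rewrite -[leRHS]mul1r -suml mulr_suml; apply: ler_sum => i _.
  by rewrite linearZr_LR/= ler_wpM2l// lerBrDr; apply: fx => /=.
by move=> + eqy; rewrite -eqy; lra.
Qed.

End PackingSeparation.

Section Ellipsoid.
Variables (R : realType) (n : nat).
Implicit Types (A B S U : 'M[R]_n) (u v y z : 'rV[R]_n).

Definition ellipsoid A : set 'rV[R]_n := (fun x => x *m A) @` @unit_ball2 R n.

Lemma unit_ball2E u : unit_ball2 u = ('[u] <= 1) :> Prop.
Proof. by rewrite /unit_ball2/= dnormE. Qed.

Lemma mem_ellipsoid A u : '[u] <= 1 -> ellipsoid A (u *m A).
Proof. by move=> u1; exists u; rewrite ?unit_ball2E. Qed.

Lemma ellipsoid0 A : ellipsoid A 0.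
Proof. by rewrite -(mul0mx _ A); apply: mem_ellipsoid; rewrite linear0l. Qed.

Lemma continuous_dnorm_mulmx A : continuous (fun u : 'rV[R]_n => '[u *m A]).
Proof.
have -> : (fun u => '[u *m A]) =
    fun u => \sum_i (\sum_k u 0 k * A k i) ^+ 2.
  by apply/funext => u; rewrite dnormE; apply: eq_bigr => i _; rewrite mxE.
apply: continuous_big => [|i _]; first by move=> p; exact: add_continuous.
move=> u; apply: (continuous_comp
  (f := fun v : 'rV[R]_n => \sum_k v 0 k * A k i) (g := fun a => a ^+ 2));
  last exact: exprn_continuous.
apply: continuous_big => [|k _]; first by move=> p; exact: add_continuous.
move=> v; apply: continuousM; first exact: coord_continuous.
exact: cst_continuous.
Qed.

Lemma interior_ellipsoid B u :
  B \in unitmx -> '[u *m invmx B] < 1 -> interior (ellipsoid B) u.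
Proof.
move=> unitB; pose sublevel := [set v : 'rV[R]_n | '[v *m invmx B] < 1].
have open_sublevel : open sublevel.
  apply: (@open_comp _ _ (fun v => '[v *m invmx B]) [set a | a < 1]).
    by move=> v _; exact: continuous_dnorm_mulmx.
  exact: open_lt.
have : sublevel `<=` ellipsoid B.
  by move=> v /= /ltW/(mem_ellipsoid B); rewrite mulmxKV.
by rewrite (open_subsetE _ open_sublevel); exact.
Qed.

Lemma disjoint_translate_ellipsoid B y z : B \in unitmx ->
    translate_int y (ellipsoid B) `&` translate_int z (ellipsoid B) = set0 ->
  4 <= '[(y - z) *m invmx B].
Proof.
move=> unitB disj; rewrite leNgt; apply/negP => lt4.
pose h := 2^-1 *: (y - z).
have h1 : '[h *m invmx B] < 1 by rewrite -scalemxAl dnormZ; lra.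
suff : (translate_int y (ellipsoid B) `&` translate_int z (ellipsoid B))
  (z + h) by rewrite disj.
split; last by exists h => //; exact: interior_ellipsoid.
exists (- h); first by apply: interior_ellipsoid; rewrite // mulNmx dnormN.
by apply/rowP => i; rewrite !mxE; field.
Qed.

Lemma packing_ok_ball_cover A B cs N : B \in unitmx ->
    packing_ok (ellipsoid (A *m B)) (ellipsoid B) N -> ball_cover A cs ->
  (N <= size cs)%N.
Proof.
move=> unitB [y [yE ydisj]] cover.
have /choice[x xP] k : exists x, '[x] <= 1 /\ x *m (A *m B) = y k.
  by have [x] := yE k; rewrite unit_ball2E; exists x.
apply: (leq_size_ball_cover cover (x := x)) => [k|k l /ydisj].
  by case: (xP k).
move/(disjoint_translate_ellipsoid unitB).
by rewrite -(xP k).2 -(xP l).2 -mulmxBl mulmxA mulmxK.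
Qed.

Lemma convsep_ok_ellipsoid S U B s c :
    S^T = S -> U *m U^T = 1%:M -> B \in unitmx -> 0 <= c < 2^-1 ->
    ball_separated S s ->
  convsep_ok (ellipsoid (S *m S *m U *m B)) (scale_set c (ellipsoid B))
    (size s).
Proof.
move=> symS orthU unitB c_range /ball_separated_enum[x [x_ball x_sep]].
pose dual u := u *m U *m (invmx B)^T.
have dualE u v : '[dual u, v *m (S *m S *m U *m B)] = '[u *m S, v *m S].
  rewrite dotrv_mulmx trmxK !mulmxA mulmxK//.
  by rewrite dotrv_orthogonal// dotrv_mulmx symS.
apply: (convsep_ok_functional (t := 2^-1)
  (x := fun i => x i *m (S *m S *m U *m B)) (f := dual \o x)).
- by move=> i; exact: mem_ellipsoid.
- move=> i j /x_sep[le_ij sep_ij]; rewrite /= !dualE.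
  exact: dotrvDhalf_le.
- move=> j _ [_ [z + <-] <-]; rewrite unit_ball2E => z1.
  rewrite linearZr_LR/= /dual dotrv_mulmx trmxK mulmxK//.
  have : '[x j *m U, - z] <= 1 by rewrite dotrv_le1 ?dnormN ?dotrv_orthogonal.
  by rewrite linearNr/=; case/andP: c_range; nra.
Qed.

Lemma packing_ok_le_sqr_convsep_ok A B c N :
    A \in unitmx -> B \in unitmx -> 0 <= c < 2^-1 ->
    packing_ok (ellipsoid A) (ellipsoid B) N ->
  exists2 m, convsep_ok (ellipsoid A) (scale_set c (ellipsoid B)) m &
    (N <= m ^ 2)%N.
Proof.
move=> unitA unitB c_range.
have unitT : A *m invmx B \in unitmx by rewrite unitmx_mul unitA unitmx_inv.
have [P [U [psdP orthU eqT]]] := polar_decomposition unitT.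
have [S [symS _] SS] := psdmx_sqrt psdP.
have -> : A = S *m S *m U *m B by rewrite SS -eqT mulmxKV.
move=> packN; have [s sepS maxs] := ex_ball_separated_cover S N.
exists (size s); first exact: convsep_ok_ellipsoid.
case: maxs => [->|cover]; first by case: (N) => // k; exact: leq_pmulr.
have {cover} := ball_cover_orthogonal orthU (ball_cover_mulmx cover cover).
move/(packing_ok_ball_cover unitB packN).
by rewrite size_map size_allpairs size_map.
Qed.

End Ellipsoid.

Section ExtendedLog.
Variable R : realType.
Implicit Types x y : \bar R.

Lemma elog2E x : (0 < x)%E -> elog2 x = (lne x * ((ln 2)^-1)%:E)%E.
Proof.
case: x => [r| |]//; first by rewrite lte_fin => r0; rewrite lne_EFin.
by rewrite gt0_mulye// lte_fin invr_gt0 ln_gt0// ltr1n.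
Qed.

Lemma elog2_le_expe x y k :
    (0 < x)%E -> (0 < y)%E -> (x <= y ^+ k)%E ->
  (elog2 x <= k%:R%:E * elog2 y)%E.
Proof.
move=> x0 y0 xyk; rewrite !elog2E// muleA mule_natl -lneXn//.
rewrite lee_wpmul2r ?lee_fin ?invr_ge0 ?ln_ge0 ?ler1n//.
by rewrite lee_lne ?in_itv/= ?leey ?andbT ?expe_ge0// ltW.
Qed.

Lemma lee_expe2r x y k : (0 <= x)%E -> (x <= y)%E -> (x ^+ k <= y ^+ k)%E.
Proof.
move=> x0 xy; elim: k => [|k IHk]; first by rewrite !expe0.
by rewrite !expeS lee_pmul// expe_ge0.
Qed.

Lemma ereal_sup_nat_le_expe (P Q : set nat) k :
    (forall N, P N -> exists2 m, Q m & (N <= m ^ k)%N) ->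
  (ereal_sup [set N%:R%:E | N in P] <=
   ereal_sup [set m%:R%:E | m in Q] ^+ k :> \bar R)%E.
Proof.
move=> PQ; apply: ge_ereal_sup => _ [N /PQ[m Qm Nm] <-].
have m_le_sup : (m%:R%:E <= ereal_sup [set m%:R%:E | m in Q] :> \bar R)%E.
  by apply: ereal_sup_ubound; exists m.
have N_le_expe : (N%:R%:E <= m%:R%:E ^+ k :> \bar R)%E.
  by rewrite -EFin_expe lee_fin -natrX ler_nat.
by apply: (le_trans N_le_expe); exact: lee_expe2r.
Qed.

Lemma elog2_sup_le (P Q : set nat) k : P 1 ->
    (forall N, P N -> exists2 m, Q m & (N <= m ^ k.+1)%N) ->
  (elog2 (ereal_sup [set N%:R%:E | N in P]) <=
   k.+1%:R%:E * elog2 (ereal_sup [set m%:R%:E | m in Q]) :> \bar R)%E.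
Proof.
move=> P1 PQ; have [m Qm] := PQ _ P1; rewrite expn_gt0 orbF => m0.
apply: elog2_le_expe (ereal_sup_nat_le_expe PQ).
- by apply: (@lt_le_trans _ _ 1%E) => //; apply: ereal_sup_ubound; exists 1.
- apply: (@lt_le_trans _ _ m%:R%:E); first by rewrite lte_fin ltr0n.
  by apply: ereal_sup_ubound; exists m.
Qed.

End ExtendedLog.

Theorem theorem2 (R : realType) :
  exists C c : R, 0 < C /\ 0 < c /\
    forall (n : nat) (E B : set 'rV[R]_n),
      is_ellipsoid E -> is_ellipsoid B ->
      (elog2 (packing_number E B) <= C%:E * elog2 (convsep_number E (scale_set c B)))%E.
Proof.
exists 2, 4^-1; split; first by []; split; first by rewrite invr_gt0.
move=> n _ _ [A [unitA ->]] [B [unitB ->]].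
apply: elog2_sup_le => [|N]; first exact: packing_ok1 (ellipsoid0 A).
by apply: packing_ok_le_sqr_convsep_ok => //; lra.
Qed.
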